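(* For all integers $n\geq 1$ and $p\geq 0$, \[ \sum_{k=0}^{n}\binom{n+1}{k}B_{k,p}=-p\,B_{n,p}. \]
   Context: For each integer $p\geq 0$, the $p$-Bernoulli numbers $B_{n,p}$ ($n\geq 0$) are defined by $B_{0,p}=1$ and the recurrence $B_{n+1,p}=pB_{n,p}-\frac{(p+1)^{2}}{p+2}B_{n,p+1}$ for $n\geq 0$, $p\geq 0$. For $p=0$ they reduce to the classical Bernoulli numbers $B_n$ (given by $\sum_{n\ge0}B_n t^n/n! = t/(e^t-1)$). *)

(* Defs.v *)
From mathcomp Require Import all_boot all_order all_algebra.

Set Implicit Arguments.
Unset Strict Implicit.
Unset Printing Implicit Defensive.

Import GRing.Theory.
Local Open Scope ring_scope.

(* [pBernoulli n p] is B_{n,p}: the order n is the first argument. *)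
Fixpoint pBernoulli (n p : nat) : rat :=
  if n is m.+1 then
    p%:R * pBernoulli m p
    - (p.+1%:R ^+ 2 / p.+2%:R) * pBernoulli m p.+1
  else 1.

(* Main.v *)
Require Import Defs.
From mathcomp Require Import all_boot all_order all_algebra.
From mathcomp Require Import ring.

Import GRing.Theory.
Local Open Scope ring_scope.

(** The binomial transform A_{n,p} of k |-> B_{k,p} satisfies
    A_{n+1,p} = (p+1) A_{n,p} - (p+1)^2/(p+2) A_{n,p+1}, by Pascal's rule.
    The recurrence of B_{n,p+1} has the same coefficient p+1, which yields
    A_{n+1,p} = -(p+1)^2/(p+2) B_{n,p+1} for n >= 1 by induction on n. The
    right-hand side is B_{n+1,p} - p B_{n,p}, and B_{n+1,p} is the top term of
    the sum A_{n+1,p}. *)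

Definition binomial_transform (R : pzRingType) (u : nat -> R) (n : nat) : R :=
  \sum_(0 <= k < n.+1) 'C(n, k)%:R * u k.

Lemma binomial_transformS (R : pzRingType) (u : nat -> R) (n : nat) :
  binomial_transform R u n.+1
  = binomial_transform R u n + binomial_transform R (fun k => u k.+1) n.
Proof.
rewrite /binomial_transform big_nat_recl // [in RHS]big_nat_recl // !bin0.
rewrite (eq_bigr (fun k => 'C(n, k.+1)%:R * u k.+1 + 'C(n, k)%:R * u k.+1));
  last by move=> k _; rewrite binS natrD mulrDl.
(* The top term, k = n, of the first sum vanishes: C(n, n+1) = 0. *)
rewrite big_split /= [X in _ + (X + _)]big_nat_recr //= bin_small // mul0r.
by rewrite addr0 addrA.
Qed.

Definition pBernoulli_transform (n p : nat) : rat :=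
  binomial_transform rat (pBernoulli^~ p) n.

Lemma pBernoulli_transformS (n p : nat) :
  pBernoulli_transform n.+1 p
  = p.+1%:R * pBernoulli_transform n p
    - (p.+1%:R ^+ 2 / p.+2%:R) * pBernoulli_transform n p.+1.
Proof.
rewrite /pBernoulli_transform binomial_transformS /binomial_transform /=.
rewrite !mulr_sumr -sumrB -big_split /=.
by apply: eq_bigr => k _; set c := _ / _; rewrite -natr1; ring.
Qed.

(** The index starts at 2 because [pBernoulli_transform 1 p] is (p+1)/(p+2), which breaks the
    pattern. *)
Lemma pBernoulli_transformE (n p : nat) :
  pBernoulli_transform n.+2 p
  = - (p.+1%:R ^+ 2 / p.+2%:R) * pBernoulli n.+1 p.+1.
Proof.
elim: n p => [|n IHn] p.
  rewrite !pBernoulli_transformS /pBernoulli_transform /binomial_transform.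
  rewrite !big_nat1 bin0 /=.
  by field; rewrite -!natrD !Num.Theory.pnatr_eq0.
(* With [IHn] at p and p+1, the factor -(p+1)^2/(p+2) comes out and leaves the recurrence for
   B_{n+2,p+1}. *)
by rewrite pBernoulli_transformS !IHn /=; ring.
Qed.

Theorem theorem1 (n p : nat) (hn : (1 <= n)%N) :
  \sum_(0 <= k < n.+1) 'C(n.+1, k)%:R * pBernoulli k p
  = - (p%:R * pBernoulli n p).
Proof.
case: n hn => // n _.
have := pBernoulli_transformE n p.
(* After the case split the top term is B_{n+2,p}. *)
rewrite /pBernoulli_transform /binomial_transform big_nat_recr //= binn mul1r.
by move=> H; apply: (addIr (pBernoulli n.+2 p)); rewrite /= H; ring.
Qed.
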